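(* Let $m,n\ge 3$ and let $e$ be any hyperedge of $\mathcal{C}^3_{m,n}$. Then $\mathcal{E_S}(\mathcal{C}^3_{m,n})>\mathcal{E_S}(\mathcal{C}^3_{m,n}-e)$.
   Context: For a hypergraph $\mathcal{H}$ and distinct vertices $i,j$, the co-degree $c_{ij}$ is the number of hyperedges containing both $i$ and $j$. The Seidel matrix $\mathcal{S}(\mathcal{H})$ has zero diagonal and $(i,j)$-entry $1-2c_{ij}$ for $i\neq j$. The Seidel energy $\mathcal{E_S}(\mathcal{H})$ is the sum of the absolute values of the eigenvalues of $\mathcal{S}(\mathcal{H})$. The complete $3$-uniform bipartite hypergraph $\mathcal{C}^3_{m,n}=(V_1,V_2,E)$ has vertex set $V_1\sqcup V_2$, $|V_1|=m$, $|V_2|=n$, and $E$ = all $3$-subsets meeting both $V_1$ and $V_2$. For a hyperedge $e$, $\mathcal{H}-e$ denotes the hypergraph with the same vertex set and hyperedge set $E\setminus\{e\}$. *)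

(* Defs.v *)
From HB Require Import structures.
From mathcomp Require Import all_boot all_order all_algebra all_field.
Set Implicit Arguments. Unset Strict Implicit. Unset Printing Implicit Defensive.
Import Order.TTheory GRing.Theory Num.Theory.
Local Open Scope ring_scope.

Definition hypergraph (N : nat) := {set {set 'I_N}}.

Definition codegree (N : nat) (E : hypergraph N) (i j : 'I_N) : nat :=
  #|[set e in E | (i \in e) && (j \in e)]|.

Definition seidel (N : nat) (E : hypergraph N) : 'M[algC]_N :=
  \matrix_(i, j) (if i == j then 0 else 1 - 2 * (codegree E i j)%:R).

(* The eigenvalues (with algebraic multiplicity) of a square complex matrix:
   the roots of its characteristic polynomial. *)
Definition spectrum (N : nat) (A : 'M[algC]_N) : seq algC :=
  sval (closed_field_poly_normal (char_poly A)).

Definition seidel_energy (N : nat) (E : hypergraph N) : algC :=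
  \sum_(z <- spectrum (seidel E)) `|z|.

Definition complete_bip3 (m n : nat) : hypergraph (m + n) :=
  [set e : {set 'I_(m + n)} | [&& #|e| == 3,
                                  [exists i in e, (i < m)%N] &
                                  [exists i in e, (m <= i)%N]]].

(* Main.v *)
(** Let A and B be the Seidel matrices of C^3_{m,n} and C^3_{m,n} - e. Both are
    real symmetric with trace zero, so the energy is twice the total absolute
    value of the negative eigenvalues; hence it is at least -2 z A z^* / z z^*
    for every z. Subtracting a rank-one matrix proportional to the all-ones
    matrix, B becomes a sum of squares plus a positive diagonal, so B is positive
    definite on the vectors with zero coordinate sum and has at most one negative
    eigenvalue -l; thus E(B) is 0 or 2l. Deleting e raises the entries of B
    indexed by pairs in e, and all off-diagonal entries of B are negative, so by
    a Perron-type argument the vector z = |x| of absolute values of an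
    eigenvector x for -l (perturbed if it has a zero entry) satisfies
    -z A z^* > l z z^*, whence E(A) > 2l. *)
Require Import Defs.
From HB Require Import structures.
From mathcomp Require Import all_boot all_order all_algebra all_field.
From mathcomp Require Import ring zify.
Import Order.TTheory GRing.Theory Num.Theory.
Local Open Scope ring_scope.
Local Open Scope sesquilinear_scope.

(** * Quadratic forms and the spectrum of a normal matrix *)

Definition qform {n} (A : 'M[algC]_n) (x : 'rV[algC]_n) : algC :=
  (x *m A *m x ^t*) 0 0.

Lemma mulmx_tconjE n (x y : 'rV[algC]_n) :
  (x *m y ^t*) 0 0 = \sum_j x 0 j * (y 0 j)^*.
Proof. by rewrite mxE; apply: eq_bigr => j _; rewrite !mxE. Qed.

Lemma mulmx_tconj_norm n (x : 'rV[algC]_n) :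
  (x *m x ^t*) 0 0 = \sum_j `|x 0 j| ^+ 2.
Proof. by rewrite mulmx_tconjE; apply: eq_bigr => j _; rewrite normCK. Qed.

(** Unitary diagonalization makes [A] similar to [diag_mx d], so both have the same characteristic
    polynomial, whose linear factors are unique up to order. *)
Lemma spectrum_spectral_diag n (A : 'M[algC]_n) : A \is normalmx ->
  perm_eq (spectrum A) [seq spectral_diag A 0 i | i <- enum 'I_n].
Proof.
move=> /orthomx_spectralP A_eq; apply: prod_XsubC_eq; rewrite big_image /=.
rewrite /spectrum; case: closed_field_poly_normal => /= s.
rewrite (monicP (char_poly_monic A)) scale1r => <-.
set P := spectralmx A; set d := spectral_diag A.
have uP : P \in unitmx by exact: spectral_unit.
have -> : \prod_i ('X - (d 0 i)%:P) = char_poly (diag_mx d).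
  rewrite char_poly_trig ?diag_mx_is_trig //.
  by apply: eq_bigr => i _; rewrite !mxE eqxx mulr1n.
rewrite /char_poly /char_poly_mx [in LHS]A_eq -/P -/d.
have -> : 'X%:M - map_mx polyC (invmx P *m diag_mx d *m P) =
  map_mx polyC (invmx P) *m ('X%:M - map_mx polyC (diag_mx d)) *m map_mx polyC P.
  rewrite mulmxBr mulmxBl !map_mxM; congr (_ - _).
  by rewrite -mulmxA mul_scalar_mx -scalemxAr -map_mxM mulVmx // map_mx1 scalemx1.
rewrite !det_mulmx mulrC mulrA -det_mulmx -map_mxM mulmxV // map_mx1 det1.
by rewrite mul1r.
Qed.

(** * Energy of Hermitian matrices of trace zero *)

Definition energy {n} (A : 'M[algC]_n) : algC := \sum_(z <- spectrum A) `|z|.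

Section Hermitian.
Variables (n : nat) (A : 'M[algC]_n).
Hypothesis hermA : A \is hermsymmx.
Let P := spectralmx A.
Let d i := spectral_diag A 0 i.

Let P_unitary : P *m P ^t* = 1%:M.
Proof. exact/unitarymxP/spectral_unitarymx. Qed.

Let P_unitaryV : P ^t* *m P = 1%:M.
Proof. exact: mulmx1C. Qed.

Let A_eq : A = P ^t* *m diag_mx (spectral_diag A) *m P.
Proof.
rewrite -invmx_unitary ?spectral_unitarymx //.
exact/orthomx_spectralP/hermitian_normalmx.
Qed.

Let d_real i : d i \is Num.real.
Proof. by have /mxOverP := hermitian_spectral_diag_real hermA; apply. Qed.

Let energyE : energy A = \sum_i `|d i|.
Proof.
rewrite /energy.
rewrite (perm_big _ (spectrum_spectral_diag _ _ (hermitian_normalmx hermA))).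
by rewrite big_image.
Qed.

Let trE : \tr A = \sum_i d i.
Proof. by rewrite A_eq mxtrace_mulC mulmxA P_unitary mul1mx mxtrace_diag. Qed.

Let qformE (c : 'rV_n) : qform A (c *m P) = \sum_i d i * `|c 0 i| ^+ 2.
Proof.
rewrite /qform A_eq trmx_mul map_mxM !mulmxA -(mulmxA c) P_unitary mulmx1.
rewrite -!mulmxA (mulmxA P) P_unitary mul1mx mulmxA mulmx_tconjE.
apply: eq_bigr => i _; rewrite mul_mx_diag mxE normCK.
by rewrite mulrA (mulrC (d i)).
Qed.

Let normE (c : 'rV_n) :
  ((c *m P) *m (c *m P) ^t*) 0 0 = \sum_i `|c 0 i| ^+ 2.
Proof.
by rewrite trmx_mul map_mxM mulmxA -(mulmxA c) P_unitary mulmx1 mulmx_tconj_norm.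
Qed.

(** In an orthonormal eigenbasis the bound holds term by term: trace zero makes [- d i] the sum of
    the other eigenvalues, so [- d i *+ 2] is at most the sum of all [|d j|]. *)
Lemma energy_ge (x : 'rV_n) : \tr A = 0 ->
  - qform A x *+ 2 <= energy A * (x *m x ^t*) 0 0.
Proof.
move=> trA0; have -> : x = x *m P ^t* *m P by rewrite -mulmxA P_unitaryV mulmx1.
rewrite qformE normE mulr_sumr -sumrN -sumrMnl; apply: ler_sum => i _.
rewrite -mulNr -mulrnAl ler_wpM2r ?exprn_ge0 // energyE (bigD1 i) //= mulr2n.
apply: lerD; first by rewrite -normrN real_ler_norm ?rpredN.
have: \sum_i d i = 0 by rewrite -trE.
rewrite (bigD1 i) //= => /eqP; rewrite addrC addr_eq0 => /eqP <-.
apply: le_trans (ler_norm_sum _ _ _).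
by rewrite real_ler_norm // rpred_sum.
Qed.

(** Two negative eigenvalues would span a plane on which the form is nonpositive, and this plane
    meets the hyperplane [x *m w = 0] in a nonzero vector. With a single negative eigenvalue [- l],
    trace zero makes the others sum to [l]. *)
Lemma energy_one_neg (w : 'cV_n) : \tr A = 0 ->
  (forall x : 'rV_n, x *m w = 0 -> x != 0 -> 0 < qform A x) ->
  energy A = 0 \/ exists l, exists2 x : 'rV_n, x != 0 &
    [/\ 0 < l, energy A = l *+ 2 & x *m A = - l *: x].
Proof.
move=> trA0 posA.
have sum_d : \sum_i d i = 0 by rewrite -trE.
case: (pickP (fun i => d i < 0)) => [i di_lt0 | d_ge0]; last first.
  left; rewrite energyE -[RHS]sum_d; apply: eq_bigr => i _.
  by rewrite ger0_norm // real_leNgt ?real0 // d_ge0.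
have P_free (c : 'rV_n) : c *m P = 0 -> c = 0.
  by move=> cP0; rewrite -[c]mulmx1 -P_unitary mulmxA cP0 mul0mx.
have d_pos j : j != i -> 0 <= d j.
  move=> ne_ji; rewrite real_leNgt ?real0 //; apply/negP => dj_lt0.
  pose s k := (P *m w) k 0.
  have qle0 (c : 'rV_n) : (forall k, k != i -> k != j -> c 0 k = 0) ->
      c *m (P *m w) = 0 -> c = 0.
    move=> c0 cw; apply/eqP/contraT => cn0.
    have /(posA _) : c *m P *m w = 0 by rewrite -mulmxA.
    have cPn0 : c *m P != 0 by apply: contra cn0 => /eqP/P_free ->.
    move=> /(_ cPn0); rewrite qformE => /lt_geF <-.
    apply: sumr_le0 => k _.
    have [-> | ki] := eqVneq k i; first by rewrite mulr_le0_ge0 ?(ltW di_lt0) ?exprn_ge0.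
    have [-> | kj] := eqVneq k j; first by rewrite mulr_le0_ge0 ?(ltW dj_lt0) ?exprn_ge0.
    by rewrite c0 // normr0 expr0n mulr0.
  (* The coefficients are chosen so that the products with [w] cancel. Since this combination must
     vanish, [s i = 0], so the [i]-th eigenvector alone already lies in the hyperplane. *)
  have c1 : s j *: delta_mx 0 i - s i *: delta_mx 0 j = 0 :> 'rV_n.
    apply: qle0 => [k ki kj|].
      by rewrite !mxE !eqxx (negPf ki) (negPf kj) !mulr0 subr0.
    rewrite mulmxBl -!scalemxAl -!rowE; apply/rowP => k.
    by rewrite !mxE ord1 /s !mxE mulrC subrr.
  have sj0 : s i = 0.
    move/rowP/(_ j): c1; rewrite !mxE !eqxx (negPf ne_ji) mulr0 mulr1 sub0r.
    by move/eqP; rewrite oppr_eq0 => /eqP.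
  have : delta_mx 0 i = 0 :> 'rV[algC]_n.
    apply: qle0 => [k ki kj|]; first by rewrite !mxE eqxx (negPf ki).
    by rewrite -rowE; apply/rowP => k; rewrite ord1 [LHS]mxE [RHS]mxE.
  by move/rowP/(_ i)/eqP; rewrite !mxE !eqxx oner_eq0.
right; exists (- d i), (row i P); last split.
- apply/negP => /eqP rP0.
  have : delta_mx 0 i = 0 :> 'rV[algC]_n by apply: P_free; rewrite -rowE.
  by move/rowP/(_ i)/eqP; rewrite !mxE !eqxx oner_eq0.
- by rewrite oppr_gt0.
- rewrite energyE (bigD1 i) //= ltr0_norm // mulr2n; congr (_ + _).
  move: sum_d; rewrite (bigD1 i) //= => /eqP; rewrite addrC addr_eq0 => /eqP <-.
  by apply: eq_bigr => j /d_pos dj; rewrite ger0_norm.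
- rewrite opprK {1}A_eq !mulmxA -row_mul P_unitary row1.
  rewrite -!mulmxA -[RHS]/(d i *: _) (rowE i P) scalemxAl mulmxA; congr (_ *m _).
  apply/rowP => j; rewrite mul_mx_diag !mxE eqxx.
  by case: eqVneq => [-> | _]; rewrite /= ?mul1r ?mulr1 // mul0r mulr0.
Qed.

End Hermitian.

(** * Perron-type comparison of two forms *)

Lemma sumr_gt0 n (F : 'I_n -> algC) (a : 'I_n) :
  (forall i, 0 <= F i) -> 0 < F a -> 0 < \sum_i F i.
Proof.
by move=> F_ge0 Fa; rewrite (bigD1 a) //= ltr_pwDl // sumr_ge0.
Qed.

Lemma qform_ge0_vec n (A : 'M[algC]_n) (z : 'rV[algC]_n) :
  (forall j, 0 <= z 0 j) ->
  qform A z = \sum_j (\sum_i z 0 i * A i j) * z 0 j.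
Proof.
move=> z0; rewrite /qform mulmx_tconjE; apply: eq_bigr => j _.
by rewrite mxE geC0_conj.
Qed.

(** As [- B] has nonnegative entries, the triangle inequality in the eigenvector equation gives
    [l * y j <= r j] for [y = |x|]. Weighting by [y] and summing bounds the form of [- B] below by
    [l] times the squared norm; only strictness remains. *)
Lemma qform_eigenvector_abs_lt n (A B : 'M[algC]_n) (l : algC) (x : 'rV[algC]_n)
    (a b : 'I_n) :
  (forall i j, A i j <= B i j) -> A a b < B a b ->
  (forall i, B i i <= 0) -> (forall i j, i != j -> B i j < 0) ->
  0 < l -> x != 0 -> x *m B = - l *: x ->
  exists z : 'rV[algC]_n, l * (z *m z ^t*) 0 0 < - qform A z.
Proof.
move=> leAB ltAB Bd Bo l_gt0 x_n0 xB.
have B_le0 i j : B i j <= 0.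
  by have [-> // | ne_ij] := eqVneq i j; rewrite ltW ?Bo.
pose y j := `|x 0 j|.
have y_ge0 j : 0 <= y j by rewrite normr_ge0.
pose r j := \sum_i y i * - B i j.
have ly j : l * y j <= r j.
  move/rowP/(_ j): xB; rewrite !mxE => /(congr1 (fun u => `|u|)) /=.
  rewrite normrM normrN (gtr0_norm l_gt0) -/(y j) => <-.
  apply: le_trans (ler_norm_sum _ _ _) _; apply: ler_sum => i _.
  by rewrite normrM (ler0_norm (B_le0 _ _)).
have qAB (z : 'rV[algC]_n) : (forall j, 0 <= z 0 j) ->
    - qform A z = \sum_j (\sum_i z 0 i * - B i j) * z 0 j
                  + \sum_j (\sum_i z 0 i * (B i j - A i j)) * z 0 j.
  move=> z0; rewrite qform_ge0_vec // -sumrN -big_split /=.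
  apply: eq_bigr => j _; rewrite -mulNr -mulrDl -sumrN -big_split /=.
  by congr (_ * _); apply: eq_bigr => i _; ring.
have dAB i j : 0 <= B i j - A i j by rewrite subr_ge0.
(* Without zero entries, [y] itself works: the strict inequality comes from the entry [(a, b)],
   which carries the positive weight [y a * y b]. *)
case: (pickP (fun k => y k == 0)) => [k /eqP yk0 | y_n0]; last first.
  have y_gt0 k : 0 < y k by rewrite lt0r y_n0 y_ge0.
  exists (\row_j y j); have z0 j : 0 <= (\row_j y j) 0 j by rewrite mxE.
  rewrite qAB // mulmx_tconj_norm mulr_sumr; apply: ltr_pwDr; last first.
    apply: ler_sum => j _; rewrite mxE ger0_norm // expr2 mulrA ler_wpM2r //.
    apply: le_trans (ly j) _; rewrite le_eqVlt; apply/orP; left; apply/eqP.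
    by apply: eq_bigr => i _; rewrite mxE.
  have t0 i j : 0 <= (\row_j y j) 0 i * (B i j - A i j) by rewrite mulr_ge0.
  apply: (sumr_gt0 _ _ b) => [j|]; first by rewrite mulr_ge0 ?sumr_ge0.
  rewrite mulr_gt0 // ?mxE //; apply: (sumr_gt0 _ _ a) => //.
  by rewrite mulr_gt0 ?subr_gt0 ?mxE.
have [h yh] : exists h, y h != 0.
  move/eqP: x_n0 => x_n0; apply/existsP/contraT; rewrite negb_exists => /forallP y0.
  case: x_n0; apply/rowP => j; rewrite mxE; apply/eqP.
  by have := y0 j; rewrite negbK normr_eq0.
have rk : 0 < r k.
  apply: (sumr_gt0 _ _ h) => [i|]; first by rewrite mulr_ge0 ?oppr_ge0.
  rewrite mulr_gt0 ?lt0r ?yh ?y_ge0 // oppr_eq0 oppr_ge0 B_le0 andbT.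
  rewrite lt_eqF // Bo //; by apply: contraNneq yh => ->; rewrite yk0.
(* If |x| vanishes at k, it is not optimal for the Rayleigh quotient of -B:
   raising the k-th entry gains to first order. *)
pose ep := r k / (l *+ 2).
have l2 : 0 < l *+ 2 by rewrite pmulrn_lgt0.
have ep_gt0 : 0 < ep by rewrite divr_gt0.
pose z := \row_j (if j == k then ep else y j).
have zy j : y j <= z 0 j.
  by rewrite mxE; case: eqP => // ->; rewrite yk0 ltW.
have z0 j : 0 <= z 0 j by exact: le_trans (zy j).
exists z; rewrite qAB // ltr_wpDr //.
  by apply: sumr_ge0 => j _; rewrite mulr_ge0 ?sumr_ge0 // => i _; rewrite mulr_ge0.
have rz j : r j <= \sum_i z 0 i * - B i j.
  by apply: ler_sum => i _; rewrite ler_wpM2r ?oppr_ge0.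
rewrite mulmx_tconj_norm (bigD1 k) //= [ltRHS](bigD1 k) //= mulrDr.
apply: ltr_leD; last first.
  rewrite mulr_sumr; apply: ler_sum => j jk.
  rewrite ger0_norm // expr2 mulrA ler_wpM2r // [z 0 j]mxE (negPf jk).
  exact: le_trans (ly j) (rz j).
rewrite ger0_norm // expr2 mulrA [z 0 k]mxE eqxx ltr_pM2r //.
apply: lt_le_trans (rz k).
(* By the choice of [ep], [l * ep] is half of [r k]. *)
have -> : r k = ep * (l *+ 2) by rewrite divfK // gt_eqF.
by rewrite mulrC ltr_pM2l // mulr2n ltrDl.
Qed.

(** * Co-degrees in the complete bipartite hypergraph *)

Lemma card_lt_split m n : #|[set k : 'I_(m + n) | (k < m)%N]| = m.
Proof.
rewrite -[RHS]card_ord -(card_imset _ (@lshift_inj m n)); apply: eq_card => k.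
rewrite inE; apply/idP/imsetP => [lt_km | [j _ ->]]; last by rewrite /= ltn_ord.
by exists (Ordinal lt_km); last exact: val_inj.
Qed.

Lemma card_ge_split m n : #|[set k : 'I_(m + n) | (m <= k)%N]| = n.
Proof.
have -> : [set k : 'I_(m + n) | (m <= k)%N] = ~: [set k : 'I_(m + n) | (k < m)%N].
  by apply/setP => k; rewrite !inE leqNgt.
by have := cardsC [set k : 'I_(m + n) | (k < m)%N]; rewrite card_lt_split card_ord => /addnI.
Qed.

(** For distinct [i] and [j], these are the [k] that complete them to a hyperedge. *)
Definition third_vertices m n (i j : 'I_(m + n)) : {set 'I_(m + n)} :=
  [set k | [&& k != i, k != j, [|| (i < m)%N, (j < m)%N | (k < m)%N]
             & [|| (m <= i)%N, (m <= j)%N | (m <= k)%N]]].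

Lemma codegree_third_vertices m n (i j : 'I_(m + n)) : i != j ->
  codegree (complete_bip3 m n) i j = #|third_vertices m n i j|.
Proof.
move=> ne_ij.
have inj : {in third_vertices m n i j &, injective (fun k => [set i; j; k])}.
  move=> k k'; rewrite !inE => /and4P[ki kj _ _] _ /setP/(_ k).
  by rewrite !inE eqxx (negPf ki) (negPf kj) /= => /esym/eqP.
rewrite -(card_in_imset inj); apply: eq_card => f; rewrite !inE.
apply/idP/imsetP => [/andP[/and3P[f3 /existsP[u /andP[uf um]] /existsP[v /andP[vf vm]]]]|].
  case/andP=> iF jF.
  have : #|f :\: [set i; j]| == 1%N.
    rewrite cardsD (eqP f3) (_ : f :&: _ = [set i; j]) ?cards2 ?ne_ij //.
    by apply/setIidPr/subsetP => k; rewrite !inE => /orP[] /eqP ->.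
  case/cards1P=> k /setP fk.
  have fE : f = [set i; j; k].
    apply/setP => l; have := fk l; rewrite !inE.
    have [-> | _] /= := eqVneq l i; first by rewrite iF.
    by have [-> | _] := eqVneq l j; first by rewrite jF.
  exists k => //; have := fk k; rewrite !inE eqxx negb_or -andbA.
  case/and3P=> -> -> _ /=; move: uf vf; rewrite fE !inE => uf vf; apply/andP; split.
    by case/orP: uf => [/orP[]|] /eqP E; move: um; rewrite E => ->; rewrite ?orbT.
  by case/orP: vf => [/orP[]|] /eqP E; move: vm; rewrite E => ->; rewrite ?orbT.
case=> k; rewrite inE => /and4P[ki kj lo hi] ->; rewrite !inE !eqxx !orbT !andbT.
apply/and3P; split.
- by rewrite setUC cardsU1 cards2 !inE negb_or ki kj ne_ij.
- apply/existsP; case/or3P: lo => h; [exists i | exists j | exists k];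
    by rewrite h !inE eqxx ?orbT.
- apply/existsP; case/or3P: hi => h; [exists i | exists j | exists k];
    by rewrite h !inE eqxx ?orbT.
Qed.

(** Two vertices of one class need a third from the other class; two vertices of different classes
    accept any third vertex. *)
Lemma codegree_bip3 m n (i j : 'I_(m + n)) : i != j ->
  codegree (complete_bip3 m n) i j =
  if (i < m)%N then if (j < m)%N then n else (m + n - 2)%N
  else if (j < m)%N then (m + n - 2)%N else m.
Proof.
move=> ne_ij; rewrite codegree_third_vertices //.
have cross : #|~: [set i; j]| = (m + n - 2)%N.
  by have := cardsC [set i; j]; rewrite cards2 ne_ij card_ord; lia.
case: ltnP => im; case: ltnP => jm.
- rewrite -[RHS](card_ge_split m n); apply: eq_card => k.
  by rewrite !inE -!(inj_eq val_inj) /=; lia.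
- by rewrite -cross; apply: eq_card => k; rewrite !inE negb_or im jm ?orbT !andbT.
- by rewrite -cross; apply: eq_card => k; rewrite !inE negb_or im jm ?orbT !andbT.
- rewrite -[RHS](card_lt_split m n); apply: eq_card => k.
  by rewrite !inE -!(inj_eq val_inj) /=; lia.
Qed.

Lemma codegreeD1 N (E : hypergraph N) (e : {set 'I_N}) (i j : 'I_N) : e \in E ->
  codegree E i j = (((i \in e) && (j \in e)) + codegree (E :\ e) i j)%N.
Proof.
move=> eE; rewrite /codegree (cardsD1 e) inE eE /=; congr addn.
by apply: eq_card => f; rewrite !inE andbA.
Qed.

(** * Strict lower bounds for the energy *)

(** Strictness in the hypothesis also rules out [z = 0], so the squared norm can be cancelled. *)
Lemma energy_gt n (A : 'M[algC]_n) (z : 'rV[algC]_n) (l : algC) :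
  A \is hermsymmx -> \tr A = 0 -> l * (z *m z ^t*) 0 0 < - qform A z ->
  l *+ 2 < energy A.
Proof.
move=> hA tA lt_lz.
have lt2 : l *+ 2 * (z *m z ^t*) 0 0 < energy A * (z *m z ^t*) 0 0.
  by apply: lt_le_trans (energy_ge _ _ hA _ tA); rewrite mulrnAl ltrMn2r.
have z_ge0 : 0 <= (z *m z ^t*) 0 0.
  by rewrite mulmx_tconj_norm sumr_ge0 // => j _; rewrite exprn_ge0.
have z_gt0 : 0 < (z *m z ^t*) 0 0.
  rewrite lt0r z_ge0 andbT; apply/eqP => z0.
  by move: lt2; rewrite z0 !mulr0 ltxx.
by rewrite ltr_pM2r in lt2.
Qed.

(** The all-ones vector serves as test vector with [l = 0]. *)
Lemma energy_gt0 n (A : 'M[algC]_n) (a b : 'I_n) :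
  A \is hermsymmx -> \tr A = 0 -> (forall i j, A i j <= 0) -> A a b < 0 ->
  0 < energy A.
Proof.
move=> hA tA A0 Aab; rewrite -[ltLHS](mul0rn _ 2).
apply: (energy_gt _ _ (const_mx 1)) => //; rewrite mul0r qform_ge0_vec => [|j].
  have term_ge0 i j : 0 <= - ((const_mx 1 : 'rV[algC]_n) 0 i * A i j).
    by rewrite mxE mul1r oppr_ge0.
  rewrite -sumrN; apply: (sumr_gt0 _ _ b) => [j|].
    by rewrite [const_mx 1 0 j]mxE mulr1 -sumrN sumr_ge0.
  rewrite [const_mx 1 0 b]mxE mulr1 -sumrN; apply: (sumr_gt0 _ _ a) => //.
  by rewrite mxE mul1r oppr_gt0.
by rewrite mxE ler01.
Qed.

(** * Seidel matrices and their decomposition into rank-one terms *)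

Lemma qformD n (A B : 'M[algC]_n) x : qform (A + B) x = qform A x + qform B x.
Proof. by rewrite /qform mulmxDr mulmxDl mxE. Qed.

Lemma qform_rank1 n c (u : 'cV[algC]_n) x :
  qform (c *: (u *m u ^t*)) x = c * `|(x *m u) 0 0| ^+ 2.
Proof.
rewrite /qform -scalemxAr -scalemxAl mxE mulmxA -(mulmxA (x *m u)); congr (_ * _).
rewrite mxE big_ord1 normCK; congr (_ * _).
by rewrite -map_mxM -trmx_mul !mxE.
Qed.

Lemma qform_diag n (g : 'rV[algC]_n) x :
  qform (diag_mx g) x = \sum_i g 0 i * `|x 0 i| ^+ 2.
Proof.
rewrite /qform mulmx_tconjE; apply: eq_bigr => i _.
by rewrite mul_mx_diag mxE normCK mulrA (mulrC (g 0 i)).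
Qed.

Lemma seidel_hermitian N (E : hypergraph N) : seidel E \is hermsymmx.
Proof.
apply/is_hermitianmxP; rewrite expr0 scale1r; apply/matrixP => i j.
rewrite !mxE eq_sym; case: eqP => _; first by rewrite conjC0.
rewrite rmorphB rmorphM /= conjC1 !conjC_nat.
congr (1 - 2 * _%:R); apply: eq_card => f.
by rewrite !inE (andbC (i \in f)).
Qed.

Lemma trace_seidel N (E : hypergraph N) : \tr (seidel E) = 0.
Proof. by rewrite /mxtrace big1 // => i _; rewrite mxE eqxx. Qed.

Lemma seidel_bip3D1_pos m n (e : {set 'I_(m + n)}) (x : 'rV[algC]_(m + n)) :
  (3 <= m)%N -> (3 <= n)%N -> e \in complete_bip3 m n ->
  x *m (const_mx 1 : 'cV_(m + n)) = 0 -> x != 0 ->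
  0 < qform (seidel (complete_bip3 m n :\ e)) x.
Proof.
move=> m3 n3 eE x1 x_n0.
pose w : 'cV[algC]_(m + n) := const_mx 1.
pose u : 'cV[algC]_(m + n) := \col_i (i < m)%:R.
pose v : 'cV[algC]_(m + n) := \col_i (m <= i)%:R.
pose t : 'cV[algC]_(m + n) := \col_i (i \in e)%:R.
pose g : 'rV[algC]_(m + n) := \row_i
  ((if (i < m)%N then 2 * n%:R - 1 else 2 * m%:R - 1) - 2 * (i \in e)%:R).
(* The coefficient of [w] is the entry [1 - 2 * (m + n - 2)] between the classes; those of [u] and
   [v] correct it to [1 - 2 * n] and [1 - 2 * m] inside them. The term in [t] adds 2 on pairs in
   [e], and [g] restores the zero diagonal. *)
have -> : seidel (complete_bip3 m n :\ e) =
    (5 - 2 * m%:R - 2 * n%:R) *: (w *m w ^t*) + (2 * m%:R - 4) *: (u *m u ^t*)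
  + (2 * n%:R - 4) *: (v *m v ^t*) + 2 *: (t *m t ^t*) + diag_mx g.
  apply/matrixP => i j; rewrite !mxE !big_ord1 !mxE !conjC_nat.
  have [-> | ne_ij] := eqVneq i j.
    by rewrite conjC1 (leqNgt m); case: (j < m)%N; case: (j \in e) => /=; ring.
  have := codegreeD1 _ _ _ i j eE; rewrite codegree_bip3 // => c_eq.
  have -> : (codegree (complete_bip3 m n :\ e) i j)%:R =
      (if (i < m)%N then if (j < m)%N then n%:R else m%:R + n%:R - 2
       else if (j < m)%N then m%:R + n%:R - 2 else m%:R)
       - ((i \in e) && (j \in e))%:R :> algC.
    apply: (addrI ((i \in e) && (j \in e))%:R).
    rewrite -[LHS]natrD -c_eq addrCA subrr addr0.
    by rewrite -natrD -natrB; [do 2![case: ifP => _] | lia].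
  rewrite conjC1 !(leqNgt m) mulr0n.
  by case: (i < m)%N; case: (j < m)%N; case: (i \in e); case: (j \in e) => /=; ring.
(* The all-ones term, the only one with a negative coefficient, vanishes on [x]. *)
rewrite !qformD !qform_rank1 qform_diag x1 mxE normr0 expr0n mulr0 add0r.
have ge4 k : (3 <= k)%N -> 0 <= 2 * k%:R - 4 :> algC.
  by move=> k3; rewrite subr_ge0 -natrM ler_nat; lia.
have g_gt0 i : 0 < g 0 i.
  rewrite mxE subr_gt0; apply: (@le_lt_trans _ _ 2).
    by rewrite -natrM ler_nat; case: (_ \in _).
  by case: ifP => _; rewrite ltrBrDr natr1 -natrM ltr_nat; lia.
rewrite ltr_wpDl //.
  by rewrite !addr_ge0 ?mulr_ge0 ?exprn_ge0 ?ge4.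
have [h xh] : exists h, x 0 h != 0.
  apply/existsP/contraT; rewrite negb_exists => /forallP x0; case/eqP: x_n0.
  by apply/rowP => j; rewrite mxE; apply/eqP; have := x0 j; rewrite negbK.
apply: (sumr_gt0 _ _ h) => [i|]; first by rewrite mulr_ge0 ?exprn_ge0 // ltW.
by rewrite mulr_gt0 // exprn_gt0 // normr_gt0.
Qed.

(** * Comparison of the two energies *)

Theorem theorem2p12 (m n : nat) (e : {set 'I_(m + n)}) :
  (3 <= m)%N -> (3 <= n)%N -> e \in complete_bip3 m n ->
  seidel_energy (complete_bip3 m n :\ e) < seidel_energy (complete_bip3 m n).
Proof.
move=> m3 n3 eE.
set A := seidel (complete_bip3 m n); set B := seidel (complete_bip3 m n :\ e).
rewrite -[ltLHS]/(energy B) -[ltRHS]/(energy A).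
have cD := fun i j => codegreeD1 _ _ _ i j eE.
have Bd i : B i i = 0 by rewrite mxE eqxx.
(* Co-degrees before deletion are at least 3 and drop by at most one, so they stay positive. *)
have Bo i j : i != j -> B i j < 0.
  move=> ne_ij; rewrite mxE (negPf ne_ij) subr_lt0 -natrM ltr1n.
  by have := cD i j; rewrite codegree_bip3 //; do 2![case: ifP => _];
    case: (_ && _); lia.
have leAB i j : A i j <= B i j.
  rewrite !mxE; case: eqP => // _; rewrite lerD2l lerN2 ler_pM2l // ler_nat cD.
  exact: leq_addl.
have hA : A \is hermsymmx := seidel_hermitian _ _.
have tA : \tr A = 0 := trace_seidel _ _.
have /card_gt1P[a [b [ae be ne_ab]]] : (1 < #|e|)%N.
  by move: eE; rewrite inE => /and3P[/eqP ->].
have ltAB : A a b < B a b.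
  rewrite !mxE (negPf ne_ab) ltrD2l ltrN2 ltr_pM2l // ltr_nat cD ae be.
  by rewrite add1n.
have A_le0 i j : A i j <= 0.
  apply: le_trans (leAB i j) _.
  by have [-> | /Bo/ltW //] := eqVneq i j; rewrite Bd.
have := energy_one_neg _ B (seidel_hermitian _ _) (const_mx 1) (trace_seidel _ _)
  (fun x => seidel_bip3D1_pos _ _ _ x m3 n3 eE).
case=> [-> | [l [x x_n0 [l_gt0 -> xB]]]].
  (* If the energy of [B] is zero, a negative entry of [A] suffices. *)
  by apply: (energy_gt0 _ _ a b) => //; exact: lt_trans ltAB (Bo _ _ ne_ab).
have Bd_le0 i : B i i <= 0 by rewrite Bd.
have [z ltz] := qform_eigenvector_abs_lt _ _ _ _ _ _ _ leAB ltAB Bd_le0 Bo l_gt0 x_n0 xB.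
exact: energy_gt ltz.
Qed.
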